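(* Let $x=\cos\theta\in[-1,1]$, $|t|<1$, $\beta,\gamma\in(-1,1)\setminus\{0\}$, $0<|q|<1$. Then $$\frac{(t\beta e^{i\theta},t\beta e^{-i\theta};q)_\infty}{(te^{i\theta},te^{-i\theta};q)_\infty}=\sum_{n=0}^\infty\frac{(\beta;q)_n}{(\gamma;q)_n}\,{}_2\phi_1\left(\begin{array}{c}\beta\gamma^{-1},\ \beta q^n\\ \gamma q^{n+1}\end{array};q,\gamma t^2\right)C_n(x;\gamma|q)\,t^n .$$
   Context: $q$-Pochhammer symbols: $(a;q)_0=1$, $(a;q)_n=(1-a)(1-aq)\cdots(1-aq^{n-1})$, $(a;q)_\infty=\prod_{n\ge0}(1-aq^n)$, and $(a_1,\ldots,a_r;q)_n=(a_1;q)_n\cdots(a_r;q)_n$ (also for $n=\infty$). Basic hypergeometric series: ${}_r\phi_s\left(\begin{array}{c}a_1,\ldots,a_r\\ b_1,\ldots,b_s\end{array};q,z\right)=\sum_{k=0}^\infty\frac{(a_1,\ldots,a_r;q)_k}{(q,b_1,\ldots,b_s;q)_k}\left((-1)^kq^{\binom k2}\right)^{1+s-r}z^k$. The continuous $q$-ultraspherical/Rogers polynomials are $C_n(x;\beta|q)=\frac{(\beta;q)_n}{(q;q)_n}e^{in\theta}\,{}_2\phi_1\left(\begin{array}{c}q^{-n},\ \beta\\ \beta^{-1}q^{1-n}\end{array};q,q\beta^{-1}e^{-2i\theta}\right)$, $x=\cos\theta$. *)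

(* Defs.v *)
From Stdlib Require Import Reals List.
From Coquelicot Require Import Coquelicot.
Import ListNotations.
Open Scope C_scope.

(* Meaningful when the limit (resp. the sum) exists; it is then unique. *)
Definition Clim (u : nat -> C) : C :=
  iota (T := C_CompleteNormedModule) (fun l : C => filterlim u eventually (locally l)).

Definition Cseries (a : nat -> C) : C :=
  iota (T := C_CompleteNormedModule) (fun l : C => is_series a l).

(* e^{i theta} for a real angle. *)
Definition cis (theta : R) : C := (cos theta, sin theta).

Fixpoint qpoch (a q : C) (n : nat) : C :=
  match n with
  | O => 1
  | S m => qpoch a q m * (1 - a * q ^ m)
  end.

Definition qpoch_inf (a q : C) : C := Clim (qpoch a q).

Definition qpochs (l : list C) (q : C) (n : nat) : C :=
  fold_right (fun a p => qpoch a q n * p) 1 l.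

Definition qpochs_inf (l : list C) (q : C) : C :=
  fold_right (fun a p => qpoch_inf a q * p) 1 l.

(* The series r-phi-s, with r = length a and s = length b.  The integer
   exponent 1 + s - r of (-1)^k q^binom(k,2) may be negative, so that power is
   written as a quotient of natural powers; the base is nonzero for q <> 0. *)
Definition qhyper_term (a b : list C) (q z : C) (k : nat) : C :=
  let w := (- (1)) ^ k * q ^ (k * (k - 1) / 2) in
  qpochs a q k / qpochs (q :: b) q k
  * (w ^ (1 + length b) / w ^ length a) * z ^ k.

Definition qhyper (a b : list C) (q z : C) : C :=
  Cseries (qhyper_term a b q z).

(* C_n(x; beta | q), with theta = acos x the angle in [0, PI] such that
   x = cos theta when -1 <= x <= 1.  The series terminates: (q^{-n}; q)_k = 0
   for k > n, so the terms with k > n are 0 even where beta = q^m makes their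
   denominator vanish. *)
Definition rogers (n : nat) (x : R) (beta q : C) : C :=
  let theta := acos x in
  qpoch beta q n / qpoch q q n * cis (INR n * theta)
  * qhyper [/ q ^ n; beta] [/ beta * (q / q ^ n)] q
      (q * / beta * cis (- (2 * theta))).

(* Main.v *)
Require Import Defs.
From Stdlib Require Import Reals List Lra Lia.
From Coquelicot Require Import Coquelicot.
Import ListNotations.
Open Scope C_scope.

(* Write S(t) for the right-hand side, P_n = C_n(x; gamma | q) and F_n(t) for
   t^n times the n-th 2phi1 with its prefactor (beta;q)_n / (gamma;q)_n, so that
   S(t) = sum_n P_n F_n(t).  The three-term recurrence of P_n and a contiguous
   relation between F_{n-1}, F_n, F_{n+1} at t and q t make the partial
   sums of (1 - 2xt + t^2) S(t) - (1 - 2 x beta t + beta^2 t^2) S(q t) telescope to 0.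
   The quadratic factors split as (1 - t e^{i theta})(1 - t e^{-i theta}) and
   likewise with beta t, so iterating t -> q t, with S(q^N t) -> 1, yields the
   infinite products. *)

(* [ring] and [field] do not recognise an equation stated in the carrier of
   one of Coquelicot's structures on [C]. *)
Ltac C_eq := match goal with |- ?l = ?r => change (l = r :> C) end.

(** Let J be the tridiagonal matrix of the three-term recurrence, so that J P = 2x P. The contiguous
    relation is its transpose: with L_n = (1 + t^2) F_n(t) - (1 + beta^2 t^2) F_n(q t) and H_n = t
    (F_n(t) - beta F_n(q t)) it reads L = J^T H. Hence the same coefficients [alpha] and [delta]
    occur in both relations, and summation by parts leaves only boundary terms. These vanish in the
    limit because P_n grows at most linearly in n while F_n(t) is at most a constant times |t|^n,
    uniformly in n. Folding (beta;q)_n / (gamma;q)_n into the coefficients of the 2phi1 makes that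
    uniformity visible. The defining 2phi1 of P_n involves q^{-n}; it is first rewritten as a
    convolution, symmetric in e^{i theta} and e^{-i theta}, whose recurrence can be checked term by
    term. The polynomials are defined through acos x, whereas the products use theta; these angles
    agree up to sign modulo 2 pi, and the products do not see the sign. *)

(** * Limits and geometrically dominated series in [C] *)

Lemma geom_sum_le (x : R) (n : nat) :
  (0 <= x < 1)%R -> (0 <= (1 - x ^ n) / (1 - x) <= 1 / (1 - x))%R.
Proof.
  intros Hx.
  assert (H0 : (0 <= x ^ n <= 1)%R).
  { split; [apply pow_le; lra|]. rewrite <- (pow1 n). apply pow_incr. lra. }
  assert (H1 : (0 < / (1 - x))%R) by (apply Rinv_0_lt_compat; lra).
  unfold Rdiv. nra.
Qed.

Lemma sum_n_Cmod_le (a : nat -> C) (M r : R) (n : nat) :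
  (0 <= r < 1)%R -> (forall k, Cmod (a k) <= M * r ^ k)%R ->
  (Cmod (sum_n a n) <= M / (1 - r))%R.
Proof.
  intros Hr Ha.
  assert (HM : (0 <= M)%R).
  { specialize (Ha O). simpl in Ha. pose proof (Cmod_ge_0 (a O)). lra. }
  assert (H : (Cmod (sum_n a n) <= M * ((1 - r ^ S n) / (1 - r)))%R).
  { induction n as [|n IH].
    - rewrite sum_O. specialize (Ha O). simpl in *.
      replace ((1 - r * 1) / (1 - r))%R with 1%R by (field; lra). lra.
    - rewrite sum_Sn. eapply Rle_trans; [apply Cmod_triangle|].
      specialize (Ha (S n)).
      replace ((1 - r ^ S (S n)) / (1 - r))%R
        with ((1 - r ^ S n) / (1 - r) + r ^ S n)%R by (simpl; field; lra).
      lra. }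
  eapply Rle_trans; [exact H|].
  replace (M / (1 - r))%R with (M * (1 / (1 - r)))%R by (field; lra).
  apply Rmult_le_compat_l; [exact HM|]. apply geom_sum_le. exact Hr.
Qed.

(** Reduces complex limits to real ones, so that squeezing and order arguments on [is_lim_seq]
    become available. *)
Lemma Cfilterlim_iff (u : nat -> C) (l : C) :
  filterlim u eventually (locally l) <->
  is_lim_seq (fun n => Cmod (u n - l)) 0.
Proof.
  split; intros H.
  - apply is_lim_seq_spec. intros eps.
    assert (H' := proj1 (filterlim_locally_ball_norm (U := C_NormedModule) u l) H eps).
    destruct H' as [N HN]. exists N. intros n Hn.
    specialize (HN n Hn). unfold ball_norm in HN.
    rewrite Rminus_0_r, Rabs_pos_eq by apply Cmod_ge_0. exact HN.
  - apply (proj2 (filterlim_locally_ball_norm (U := C_NormedModule) u l)). intros eps.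
    apply is_lim_seq_spec in H. destruct (H eps) as [N HN].
    exists N. intros n Hn. specialize (HN n Hn).
    rewrite Rminus_0_r, Rabs_pos_eq in HN by apply Cmod_ge_0. exact HN.
Qed.

Lemma ex_series_geom_dominated (a : nat -> C) (M r : R) :
  (0 <= r < 1)%R -> (forall k, Cmod (a k) <= M * r ^ k)%R -> ex_series a.
Proof.
  intros Hr Ha.
  apply (ex_series_le (V := C_CompleteNormedModule) a (fun k => M * r ^ k)%R).
  - exact Ha.
  - apply (ex_series_scal_l (V := R_NormedModule) M (fun k => r ^ k)%R). apply ex_series_geom.
    rewrite Rabs_pos_eq; lra.
Qed.

Lemma Cmod_limit_le (u : nat -> C) (l : C) (M : R) :
  filterlim u eventually (locally l) -> (forall n, Cmod (u n) <= M)%R ->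
  (Cmod l <= M)%R.
Proof.
  intros Hu HM. apply Cfilterlim_iff in Hu.
  assert (H : Rbar_le (Cmod l - M)%R 0%R).
  { apply (is_lim_seq_le (fun _ => (Cmod l - M)%R) (fun n => Cmod (u n - l))).
    - intros n. specialize (HM n).
      assert (E : (Cmod l <= Cmod (u n) + Cmod (u n - l))%R).
      { replace l with (u n + - (u n - l)) at 1 by ring.
        eapply Rle_trans; [apply Cmod_triangle|]. rewrite Cmod_opp. lra. }
      lra.
    - apply is_lim_seq_const.
    - exact Hu. }
  simpl in H. lra.
Qed.

Lemma is_series_Cmod_le (a : nat -> C) (l : C) (M r : R) :
  (0 <= r < 1)%R -> (forall k, Cmod (a k) <= M * r ^ k)%R -> is_series a l ->
  (Cmod l <= M / (1 - r))%R.
Proof.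
  intros Hr Ha Hl. apply (Cmod_limit_le (sum_n a)); [exact Hl|].
  intros n. apply sum_n_Cmod_le; assumption.
Qed.

Lemma is_series_unique_C (a : nat -> C) (l l' : C) :
  is_series a l -> is_series a l' -> l = l'.
Proof. exact (filterlim_locally_unique (V := C_NormedModule) (sum_n a) l l'). Qed.

Lemma Cseries_unique (a : nat -> C) (l : C) : is_series a l -> Cseries a = l.
Proof.
  intros H. unfold Cseries.
  apply (iota_unique (V := C_CompleteNormedModule)); [|exact H].
  intros y Hy. exact (is_series_unique_C a y l Hy H).
Qed.

Lemma Cseries_correct (a : nat -> C) : ex_series a -> is_series a (Cseries a).
Proof. intros [l Hl]. rewrite (Cseries_unique a l Hl). exact Hl. Qed.

Lemma Clim_unique (u : nat -> C) (l : C) :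
  filterlim u eventually (locally l) -> Clim u = l.
Proof.
  intros H. unfold Clim.
  apply (iota_filterlim_locally (V := C_CompleteNormedModule) u l H).
Qed.

Lemma filterlim_Cmult (u v : nat -> C) (a b : C) :
  filterlim u eventually (locally a) -> filterlim v eventually (locally b) ->
  filterlim (fun n => u n * v n) eventually (locally (a * b)).
Proof.
  rewrite !Cfilterlim_iff. intros Hu Hv.
  apply (is_lim_seq_le_le (fun _ => 0%R) _
    (fun n => Cmod (u n - a) * Cmod (v n - b)
              + (Cmod (u n - a) * Cmod b + Cmod a * Cmod (v n - b)))%R).
  - intros n. split; [apply Cmod_ge_0|].
    replace (u n * v n - a * b)
      with ((u n - a) * (v n - b) + ((u n - a) * b + a * (v n - b))) by ring.
    rewrite <- !Cmod_mult.
    eapply Rle_trans; [apply Cmod_triangle|].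
    apply Rplus_le_compat_l, Cmod_triangle.
  - apply is_lim_seq_const.
  - replace (Finite 0) with (Finite (0 * 0 + (0 * Cmod b + Cmod a * 0)))
      by (f_equal; ring).
    exact (is_lim_seq_plus' _ _ _ _ (is_lim_seq_mult' _ _ _ _ Hu Hv)
      (is_lim_seq_plus' _ _ _ _
        (is_lim_seq_mult' _ _ _ _ Hu (is_lim_seq_const (Cmod b)))
        (is_lim_seq_mult' _ _ _ _ (is_lim_seq_const (Cmod a)) Hv))).
Qed.

Lemma is_series_comb (c d : C) (a b : nat -> C) (la lb : C) :
  is_series a la -> is_series b lb ->
  is_series (fun n => c * a n + d * b n) (c * la + d * lb).
Proof.
  intros Ha Hb.
  exact (is_series_plus _ _ _ _ (is_series_scal c a la Ha) (is_series_scal d b lb Hb)).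
Qed.

(** Serves the limits at 0: the term of index 0 carries the limit and the tail is small. *)
Lemma is_series_Cmod_head_le (a : nat -> C) (l : C) (M r : R) :
  (0 <= r < 1)%R -> (forall k, Cmod (a (S k)) <= M * r ^ k)%R -> is_series a l ->
  (Cmod (l - a O) <= M / (1 - r))%R.
Proof.
  intros Hr Ha Hl.
  apply (is_series_Cmod_le (fun k => a (S k)) (l - a O) M r Hr Ha).
  apply is_series_incr_1. change (is_series a (l - a O + a O)).
  replace (l - a O + a O) with l by ring. exact Hl.
Qed.

Lemma is_series_finite (a : nat -> C) (N : nat) :
  (forall k, (N < k)%nat -> a k = 0) -> is_series a (sum_n a N).
Proof.
  intros Ha. apply (filterlim_ext_loc (fun _ => sum_n a N)); [|apply filterlim_const].
  exists N. intros n Hn. induction Hn as [|n Hn IH]; [reflexivity|].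
  rewrite sum_Sn, <- IH, Ha by lia. symmetry. exact (Cplus_0_r (sum_n a N)).
Qed.

(** * q-shifted factorials *)

Lemma exp_le_compat (x y : R) : (x <= y)%R -> (exp x <= exp y)%R.
Proof.
  intros [H|H]; [left; apply exp_increasing; exact H|rewrite H; apply Rle_refl].
Qed.

(** Each factor satisfies |1 - a q^k| <= 1 + A |q|^k <= exp(A |q|^k), and the exponents add up to a
    geometric sum; the bound does not depend on [n]. *)
Lemma qpoch_Cmod_le (A : R) (a q : C) (n : nat) :
  (Cmod a <= A)%R -> (Cmod q < 1)%R ->
  (Cmod (qpoch a q n) <= exp (A / (1 - Cmod q)))%R.
Proof.
  intros Ha Hq. pose proof (Cmod_ge_0 q) as Hq0. pose proof (Cmod_ge_0 a) as Ha0.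
  set (x := Cmod q) in *.
  assert (H : (Cmod (qpoch a q n) <= exp (A * ((1 - x ^ n) / (1 - x))))%R).
  { induction n as [|n IH].
    - simpl. rewrite Cmod_1. replace (A * ((1 - 1) / (1 - x)))%R with 0%R by (field; lra).
      rewrite exp_0. lra.
    - simpl qpoch. rewrite Cmod_mult.
      replace (A * ((1 - x ^ S n) / (1 - x)))%R
        with (A * ((1 - x ^ n) / (1 - x)) + A * x ^ n)%R by (simpl; field; lra).
      rewrite exp_plus.
      apply Rmult_le_compat; try apply Cmod_ge_0; [exact IH|].
      assert (Hx : (0 <= x ^ n)%R) by (apply pow_le; lra).
      eapply Rle_trans; [apply Cmod_triangle|].
      rewrite Cmod_1, Cmod_opp, Cmod_mult, Cmod_pow. fold x.
      eapply Rle_trans; [|apply exp_ineq1_le]. nra. }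
  eapply Rle_trans; [exact H|]. apply exp_le_compat.
  replace (A / (1 - x))%R with (A * (1 / (1 - x)))%R by (field; lra).
  apply Rmult_le_compat_l; [lra|]. apply geom_sum_le. lra.
Qed.

(** Take inverses: 1/(1 - y) = 1 + y/(1 - y) <= 1 + y/(1 - A) <= exp(y/(1 - A)). *)
Lemma exp_opp_le (A y : R) :
  (A < 1)%R -> (0 <= y <= A)%R -> (exp (- (y / (1 - A))) <= 1 - y)%R.
Proof.
  intros HA Hy. rewrite exp_Ropp.
  assert (H1 : (1 + y / (1 - A) <= exp (y / (1 - A)))%R) by apply exp_ineq1_le.
  assert (H2 : (/ (1 - y) <= 1 + y / (1 - A))%R).
  { replace (/ (1 - y))%R with (1 + y * / (1 - y))%R by (field; lra).
    apply Rplus_le_compat_l, Rmult_le_compat_l; [lra|].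
    apply Rinv_le_contravar; lra. }
  rewrite <- (Rinv_inv (1 - y)). apply Rinv_le_contravar; [|lra].
  apply Rinv_0_lt_compat. lra.
Qed.

(** Here [exp_opp_le] bounds each factor from below, with y = A |q|^k. Since the bound is positive
    and independent of [n], it also survives the passage to the infinite product. *)
Lemma qpoch_Cmod_ge (A : R) (a q : C) (n : nat) :
  (Cmod a <= A < 1)%R -> (Cmod q < 1)%R ->
  (exp (- (A / (1 - A) / (1 - Cmod q))) <= Cmod (qpoch a q n))%R.
Proof.
  intros Ha Hq. pose proof (Cmod_ge_0 q) as Hq0. pose proof (Cmod_ge_0 a) as Ha0.
  set (x := Cmod q) in *.
  assert (H : (exp (- (A / (1 - A) * ((1 - x ^ n) / (1 - x)))) <= Cmod (qpoch a q n))%R).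
  { induction n as [|n IH].
    - simpl. rewrite Cmod_1.
      replace (- (A / (1 - A) * ((1 - 1) / (1 - x))))%R with 0%R by (field; lra).
      rewrite exp_0. lra.
    - simpl qpoch. rewrite Cmod_mult.
      replace (- (A / (1 - A) * ((1 - x ^ S n) / (1 - x))))%R
        with (- (A / (1 - A) * ((1 - x ^ n) / (1 - x))) + - ((A * x ^ n) / (1 - A)))%R
        by (simpl; field; lra).
      rewrite exp_plus.
      assert (Hx : (0 <= x ^ n <= 1)%R).
      { split; [apply pow_le; lra|]. rewrite <- (pow1 n). apply pow_incr. lra. }
      apply Rmult_le_compat; try (left; apply exp_pos); [exact IH|].
      eapply Rle_trans; [apply exp_opp_le; [lra|nra]|].
      assert (E : (1 <= Cmod (1 - a * q ^ n) + Cmod a * x ^ n)%R).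
      { pose proof (Cmod_triangle (1 - a * q ^ n) (a * q ^ n)) as E.
        replace (1 - a * q ^ n + a * q ^ n) with (RtoC 1) in E by ring.
        rewrite Cmod_1, (Cmod_mult a), Cmod_pow in E. exact E. }
      nra. }
  eapply Rle_trans; [|exact H]. apply exp_le_compat, Ropp_le_contravar.
  replace (A / (1 - A) / (1 - x))%R with (A / (1 - A) * (1 / (1 - x)))%R
    by (field; lra).
  apply Rmult_le_compat_l; [|apply geom_sum_le; lra].
  apply Rmult_le_pos; [lra|]. left; apply Rinv_0_lt_compat; lra.
Qed.

Lemma qpoch_neq_0 (a q : C) (n : nat) :
  (Cmod a < 1)%R -> (Cmod q < 1)%R -> qpoch a q n <> 0.
Proof.
  intros Ha Hq. apply Cmod_gt_0.
  eapply Rlt_le_trans; [|apply (qpoch_Cmod_ge (Cmod a)); lra]. apply exp_pos.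
Qed.

Lemma qpoch_cv (a q : C) :
  (Cmod q < 1)%R -> filterlim (qpoch a q) eventually (locally (qpoch_inf a q)).
Proof.
  intros Hq. pose proof (Cmod_ge_0 q) as Hq0.
  (* [e] lists the increments of the partial products, so convergence of the product becomes
     convergence of a series dominated by multiples of |q|^m. *)
  set (e := fun n => match n with O => RtoC 1 | S m => - (a * q ^ m * qpoch a q m) end).
  assert (He : forall n, sum_n e n = qpoch a q n).
  { induction n as [|n IH]; [rewrite sum_O; reflexivity|].
    rewrite sum_Sn, IH. change (plus ?u ?v) with (Cplus u v). simpl. ring. }
  assert (Hs : ex_series e).
  { apply ex_series_incr_1.
    apply (ex_series_geom_dominated _ (Cmod a * exp (Cmod a / (1 - Cmod q))) (Cmod q)); [lra|].
    intros k. unfold e. rewrite Cmod_opp, !Cmod_mult, Cmod_pow.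
    assert (H := qpoch_Cmod_le (Cmod a) a q k (Rle_refl _) Hq).
    assert (H1 : (0 <= Cmod a * Cmod q ^ k)%R)
      by (apply Rmult_le_pos; [apply Cmod_ge_0|apply pow_le; lra]).
    nra. }
  destruct Hs as [l Hl].
  assert (H : filterlim (qpoch a q) eventually (locally l)).
  { apply (filterlim_ext (sum_n e)); [exact He|exact Hl]. }
  unfold qpoch_inf. rewrite (Clim_unique _ l H). exact H.
Qed.

Lemma qpoch_inf_neq_0 (a q : C) :
  (Cmod a < 1)%R -> (Cmod q < 1)%R -> qpoch_inf a q <> 0.
Proof.
  intros Ha Hq H0. assert (H := qpoch_cv a q Hq). rewrite H0 in H.
  apply Cfilterlim_iff in H.
  assert (L : Rbar_le (exp (- (Cmod a / (1 - Cmod a) / (1 - Cmod q)))) 0%R).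
  { apply (is_lim_seq_le
      (fun _ => exp (- (Cmod a / (1 - Cmod a) / (1 - Cmod q))))
      (fun n => Cmod (qpoch a q n - 0))); [|apply is_lim_seq_const|exact H].
    intros n. replace (qpoch a q n - 0) with (qpoch a q n) by ring.
    apply qpoch_Cmod_ge; lra. }
  simpl in L. pose proof (exp_pos (- (Cmod a / (1 - Cmod a) / (1 - Cmod q)))). lra.
Qed.

Lemma qpoch_add (a q : C) (n k : nat) :
  qpoch a q (n + k) = qpoch a q n * qpoch (a * q ^ n) q k.
Proof.
  induction k as [|k IH].
  - rewrite Nat.add_0_r. simpl. ring.
  - rewrite Nat.add_succ_r. simpl. rewrite IH, Cpow_add_r. ring.
Qed.

(** * Rogers polynomials *)

(** The equation is stated in [C] with [Cplus], so that [ring] applies after rewriting. *)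
Lemma sum_n_S (a : nat -> C) (n : nat) :
  sum_n a (S n) = sum_n a n + a (S n) :> C.
Proof. exact (sum_Sn a n). Qed.

Lemma sum_n_0 (a : nat -> C) : sum_n a 0 = a O :> C.
Proof. exact (sum_O a). Qed.

Lemma sum_n_comb (c d : C) (a b : nat -> C) (n : nat) :
  sum_n (fun k => c * a k + d * b k) n = c * sum_n a n + d * sum_n b n :> C.
Proof.
  induction n as [|n IH]; [rewrite !sum_n_0; reflexivity|].
  rewrite !sum_n_S, IH.
 ring.
Qed.

Lemma sum_n_head (f : nat -> C) (n : nat) :
  sum_n f (S n) = f O + sum_n (fun k => f (S k)) n :> C.
Proof.
  induction n as [|n IH]; [rewrite sum_n_S, !sum_n_0; reflexivity|].
  rewrite sum_n_S, IH, sum_n_S.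
 ring.
Qed.

Lemma sum_n_Cmod_le_const (f : nat -> C) (M : R) (n : nat) :
  (forall k, Cmod (f k) <= M)%R -> (Cmod (sum_n f n) <= INR (S n) * M)%R.
Proof.
  intros Hf. induction n as [|n IH].
  - rewrite sum_n_0. specialize (Hf O). simpl. lra.
  - rewrite sum_n_S. eapply Rle_trans; [apply Cmod_triangle|].
    rewrite (S_INR (S n)). specialize (Hf (S n)). lra.
Qed.

Definition conv (a b : nat -> C) (n : nat) : C :=
  sum_n (fun k => a k * b (n - k)%nat) n.

(** Multiplication of a power series by its variable. The padding by 0 lets convolutions of
    different orders be written over one common range of summation. *)
Definition shift (a : nat -> C) (k : nat) : C :=
  match k with O => RtoC 0 | S m => a m end.

Lemma conv_shift_l (a b : nat -> C) (n : nat) :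
  conv (shift a) b (S n) = conv a b n.
Proof. unfold conv. rewrite sum_n_head. simpl. ring. Qed.

Lemma conv_shift_r (a b : nat -> C) (n : nat) :
  conv a (shift b) (S n) = conv a b n.
Proof.
  unfold conv. rewrite sum_n_S, Nat.sub_diag.
 change (shift b 0) with (RtoC 0).
  rewrite Cmult_0_r, Cplus_0_r. apply sum_n_ext_loc. intros k Hk.
  replace (S n - k)%nat with (S (n - k)) by lia. reflexivity.
Qed.

(* With [z = e^{i theta}] and [w = e^{- i theta}] this is [C_n(cos theta; g | q)]. *)
Definition rogers_sum (g q z w : C) : nat -> C :=
  conv (fun k => qpoch g q k / qpoch q q k * w ^ k)
       (fun k => qpoch g q k / qpoch q q k * z ^ k).

Lemma Cinv_neq_0 (a : C) : a <> 0 -> / a <> 0.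
Proof.
  intros Ha H. apply Cinv_r in Ha. rewrite H, Cmult_0_r in Ha.
  apply (RtoC_inj 0 1) in Ha. lra.
Qed.

Lemma one_minus_neq_0 (a : C) : (Cmod a < 1)%R -> 1 - a <> 0.
Proof.
  intros Ha H. replace a with (1 - (1 - a)) in Ha by ring.
  rewrite H in Ha. replace (1 - 0) with (RtoC 1) in Ha by ring.
  rewrite Cmod_1 in Ha. lra.
Qed.

Lemma Cmod_mult_pow_lt (a q : C) (n : nat) :
  (Cmod a < 1)%R -> (Cmod q < 1)%R -> (Cmod (a * q ^ n) < 1)%R.
Proof.
  intros Ha Hq. rewrite Cmod_mult, Cmod_pow.
  assert (H : (0 <= Cmod q ^ n <= 1)%R).
  { pose proof (Cmod_ge_0 q). split; [apply pow_le; lra|].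
    rewrite <- (pow1 n). apply pow_incr. lra. }
  pose proof (Cmod_ge_0 a). nra.
Qed.

Lemma one_minus_mult_pow_neq_0 (a q : C) (n : nat) :
  (Cmod a < 1)%R -> (Cmod q < 1)%R -> 1 - a * q ^ n <> 0.
Proof. intros Ha Hq. apply one_minus_neq_0, Cmod_mult_pow_lt; assumption. Qed.

Lemma rogers_sum_0 (g q z w : C) : rogers_sum g q z w 0 = 1.
Proof. unfold rogers_sum, conv. rewrite sum_n_0. simpl. field. Qed.

Lemma rogers_sum_rec_0 (g q z w : C) :
  (Cmod q < 1)%R ->
  (z + w) * (1 - g) * rogers_sum g q z w 0 = (1 - q) * rogers_sum g q z w 1.
Proof.
  intros Hq. rewrite rogers_sum_0. unfold rogers_sum, conv.
  rewrite sum_n_S, sum_n_0. simpl.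
  field. apply one_minus_neq_0. exact Hq.
Qed.

(** With shifts inserted, all four convolutions run over k + j = n + 2, and the recurrence then
    holds summand by summand: it is a rational identity in q^k and q^j. *)
Lemma rogers_sum_rec (g q z w : C) (n : nat) :
  (Cmod q < 1)%R ->
  (z + w) * (1 - g * q ^ S n) * rogers_sum g q z w (S n) =
  (1 - q ^ S (S n)) * rogers_sum g q z w (S (S n))
  + z * w * (1 - g ^ 2 * q ^ n) * rogers_sum g q z w n.
Proof.
  intros Hq. unfold rogers_sum.
  set (a := fun k => qpoch g q k / qpoch q q k * w ^ k).
  set (b := fun k => qpoch g q k / qpoch q q k * z ^ k).
  assert (H : conv (shift a) b (S (S n)) = conv a b (S n)) by apply conv_shift_l.
  assert (H1 : conv a (shift b) (S (S n)) = conv a b (S n)) by apply conv_shift_r.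
  assert (H2 : conv (shift a) (shift b) (S (S n)) = conv a b n)
    by (rewrite conv_shift_l; apply conv_shift_r).
  assert (E : (1 - q ^ S (S n)) * conv a b (S (S n))
      + z * w * (1 - g ^ 2 * q ^ n) * conv (shift a) (shift b) (S (S n))
      = w * (1 - g * q ^ S n) * conv (shift a) b (S (S n))
        + z * (1 - g * q ^ S n) * conv a (shift b) (S (S n))).
  { unfold conv. rewrite <- !sum_n_comb. apply sum_n_ext_loc. intros k Hk.
    C_eq.
    remember (S (S n) - k)%nat as j eqn:Hj.
    assert (Hkj : (k + j = S (S n))%nat) by lia. clear Hk Hj.
    assert (Hp := fun i => qpoch_neq_0 q q i Hq Hq).
    assert (Hs := fun i => one_minus_mult_pow_neq_0 q q i Hq Hq).
    (* On the edges k = 0 and j = 0 a shifted factor is the padding 0, so they need their own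
       computation; they cannot meet, as k + j = n + 2. *)
    destruct k as [|k]; [|destruct j as [|j]].
    - simpl in Hkj. subst j. unfold shift, a, b.
      rewrite (Cpow_S q (S n)), (Cpow_S z (S n)).
      change (qpoch g q (S (S n))) with (qpoch g q (S n) * (1 - g * q ^ S n)).
      change (qpoch q q (S (S n))) with (qpoch q q (S n) * (1 - q * q ^ S n)).
      generalize (Hp (S n)), (Hs (S n)). generalize (q ^ S n), (qpoch q q (S n)), (qpoch g q (S n)).
      intros Q p r hp hs. simpl. field.
      repeat split; assumption.
    - rewrite Nat.add_0_r in Hkj. injection Hkj as ->. unfold shift, a, b.
      rewrite (Cpow_S q (S n)), (Cpow_S w (S n)).
      change (qpoch g q (S (S n))) with (qpoch g q (S n) * (1 - g * q ^ S n)).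
      change (qpoch q q (S (S n))) with (qpoch q q (S n) * (1 - q * q ^ S n)).
      generalize (Hp (S n)), (Hs (S n)). generalize (q ^ S n), (qpoch q q (S n)), (qpoch g q (S n)).
      intros Q p r hp hs. simpl. field.
      repeat split; assumption.
    - assert (n = (k + j)%nat) as -> by lia. unfold shift, a, b.
      rewrite !Cpow_S, !Cpow_add_r. simpl qpoch.
      generalize (Hp k), (Hp j), (Hs k), (Hs j). simpl (g ^ 2).
      generalize (q ^ k), (q ^ j), (qpoch q q k), (qpoch q q j), (w ^ k), (z ^ j),
        (qpoch g q k), (qpoch g q j).
      intros. field. repeat split; assumption. }
  rewrite H, H1, H2 in E. rewrite E. ring.
Qed.

(** There are n + 1 summands, and (g;q)_k / (q;q)_k is bounded uniformly in k, by the upper bound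
    for the numerator over the lower bound for the denominator. *)
Lemma rogers_sum_Cmod_le (g q z w : C) :
  (Cmod q < 1)%R -> Cmod z = 1%R -> Cmod w = 1%R ->
  exists B, forall n, (Cmod (rogers_sum g q z w n) <= INR (S n) * B)%R.
Proof.
  intros Hq Hz Hw.
  set (c := (exp (Cmod g / (1 - Cmod q)) / exp (- (Cmod q / (1 - Cmod q) / (1 - Cmod q))))%R).
  assert (Hc : forall k, (Cmod (qpoch g q k / qpoch q q k) <= c)%R).
  { intros k. rewrite Cmod_div by (apply qpoch_neq_0; assumption).
    apply Rmult_le_compat.
    - apply Cmod_ge_0.
    - left. apply Rinv_0_lt_compat. apply Cmod_gt_0, qpoch_neq_0; assumption.
    - apply qpoch_Cmod_le; [apply Rle_refl|exact Hq].
    - apply Rinv_le_contravar; [apply exp_pos|].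
      apply qpoch_Cmod_ge; [split; [apply Rle_refl|exact Hq]|exact Hq]. }
  exists (c * c)%R. intros n. apply sum_n_Cmod_le_const. intros k.
  rewrite !Cmod_mult, !Cmod_pow, Hz, Hw, !pow1, !Rmult_1_r.
  apply Rmult_le_compat; try apply Cmod_ge_0; apply Hc.
Qed.

(** Read backwards, the factors of (q^{-n};q)_k and (g^{-1} q^{1-n};q)_k are, up to monomials, the
    last k factors of (q;q)_n and (g;q)_n, and so cancel them; (q/g)^k absorbs the monomials. The
    induction on [k] keeps [n] fixed and lowers [m], and it carries the nonvanishing of the
    denominator along. *)
Lemma qpoch_reverse (g q : C) (k : nat) :
  g <> 0 -> q <> 0 -> (Cmod g < 1)%R -> (Cmod q < 1)%R ->
  forall m n, n = (m + k)%nat ->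
  qpoch (/ g * (q / q ^ n)) q k <> 0 /\
  qpoch g q n / qpoch q q n
  * (qpoch (/ q ^ n) q k / qpoch (/ g * (q / q ^ n)) q k) * (q * / g) ^ k
  = qpoch g q m / qpoch q q m.
Proof.
  intros g0 q0 Hg Hq.
  induction k as [|k IH]; intros m n Hn.
  - rewrite Nat.add_0_r in Hn. subst n. split.
    + simpl. intros H. apply (RtoC_inj 1 0) in H. lra.
    + simpl. field. apply qpoch_neq_0; assumption.
  - destruct (IH (S m) n ltac:(lia)) as [Hd E].
    assert (Hm : 1 - g * q ^ m <> 0) by (apply one_minus_mult_pow_neq_0; assumption).
    assert (Hf : 1 - / g * (q / q ^ n) * q ^ k = - (1 - g * q ^ m) / (g * q ^ m)).
    { replace n with (S m + k)%nat by lia. rewrite Cpow_add_r, Cpow_S.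
      field. repeat split; try apply Cpow_nz; assumption. }
    assert (Hd' : qpoch (/ g * (q / q ^ n)) q (S k) <> 0).
    { simpl. apply Cmult_neq_0; [exact Hd|]. rewrite Hf.
      apply Cmult_neq_0.
      - intros H. apply Hm. replace (1 - g * q ^ m) with (- - (1 - g * q ^ m)) by ring.
        rewrite H. ring.
      - apply Cinv_neq_0, Cmult_neq_0; [|apply Cpow_nz]; assumption. }
    split; [exact Hd'|].
    assert (Hm1 : 1 - q * q ^ m <> 0) by (apply one_minus_mult_pow_neq_0; assumption).
    simpl qpoch in E |- *. rewrite Cpow_S.
    rewrite Hf.
    assert (Hu : 1 - / q ^ n * q ^ k = - (1 - q * q ^ m) / (q * q ^ m)).
    { replace n with (S m + k)%nat by lia. rewrite Cpow_add_r, Cpow_S.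
      field. repeat split; try apply Cpow_nz; assumption. }
    rewrite Hu.
    transitivity (qpoch g q m * (1 - g * q ^ m) / (qpoch q q m * (1 - q * q ^ m))
      * ((1 - q * q ^ m) / (1 - g * q ^ m))).
    + rewrite <- E. field.
      assert (Hn0 := qpoch_neq_0 q q n Hq Hq).
      repeat split; try apply Cpow_nz; try assumption.
    + field. repeat split; try assumption. apply qpoch_neq_0; assumption.
Qed.

Lemma cis_add (a b : R) : cis (a + b) = cis a * cis b.
Proof. unfold cis, Cmult. simpl. rewrite cos_plus, sin_plus. f_equal; ring. Qed.

Lemma cis_0 : cis 0 = 1.
Proof. unfold cis. rewrite cos_0, sin_0. reflexivity. Qed.

Lemma cis_mult_opp (a : R) : cis a * cis (- a) = 1.
Proof. rewrite <- cis_add, Rplus_opp_r. apply cis_0. Qed.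

Lemma cis_INR_mult (n : nat) (a : R) : cis (INR n * a) = cis a ^ n.
Proof.
  induction n as [|n IH].
  - simpl. rewrite Rmult_0_l. apply cis_0.
  - rewrite S_INR, Rmult_plus_distr_r, Rmult_1_l, cis_add, IH, Cpow_S. ring.
Qed.

Lemma Cmod_cis (a : R) : Cmod (cis a) = 1%R.
Proof.
  unfold Cmod, cis. simpl.
  replace (cos a * (cos a * 1) + sin a * (sin a * 1))%R with 1%R; [apply sqrt_1|].
  pose proof (sin2_cos2 a) as H. unfold Rsqr in H. lra.
Qed.

(** For r = 2 and s = 1 the exponent 1 + s - r is 0, and the quotient encoding it is w^2 / w^2 with
    w nonzero. *)
Lemma qhyper_term_21 (a b c q z : C) (k : nat) :
  q <> 0 ->
  qhyper_term [a; b] [c] q z k =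
  qpoch a q k * qpoch b q k / (qpoch q q k * qpoch c q k) * z ^ k.
Proof.
  intros Hq. unfold qhyper_term. simpl length.
  change (1 + 1)%nat with 2%nat.
  set (w := (- (1)) ^ k * q ^ (k * (k - 1) / 2)).
  assert (Hw : w <> 0).
  { apply Cmult_neq_0; apply Cpow_nz; [|exact Hq].
    intros H. assert (H1 := Cmod_m1). rewrite H, Cmod_0 in H1. lra. }
  replace (w ^ 2 / w ^ 2) with (RtoC 1) by (field; exact Hw).
  unfold qpochs. simpl fold_right. rewrite !Cmult_1_r. reflexivity.
Qed.

Lemma qpoch_pow_inv_eq_0 (q : C) (n k : nat) :
  q <> 0 -> (n < k)%nat -> qpoch (/ q ^ n) q k = 0.
Proof.
  intros Hq. induction k as [|k IH]; intros Hk; [lia|]. simpl.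
  destruct (Nat.eq_dec n k) as [->|Hn].
  - rewrite Cinv_l by (apply Cpow_nz; exact Hq). ring.
  - rewrite IH by lia. ring.
Qed.

Lemma rogers_eq_rogers_sum (n : nat) (x : R) (g q : C) :
  g <> 0 -> q <> 0 -> (Cmod g < 1)%R -> (Cmod q < 1)%R ->
  rogers n x g q = rogers_sum g q (cis (acos x)) (cis (- acos x)) n.
Proof.
  intros g0 q0 Hg Hq. unfold rogers. set (phi := acos x).
  assert (Hzw := cis_mult_opp phi).
  rewrite cis_INR_mult.
  replace (- (2 * phi))%R with (- phi + - phi)%R by ring. rewrite cis_add.
  set (z := cis phi) in *. set (w := cis (- phi)) in *.
  unfold qhyper.
  erewrite Cseries_unique;
    [|apply (is_series_finite _ n); intros k Hk;
      rewrite qhyper_term_21 by exact q0;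
      rewrite (qpoch_pow_inv_eq_0 q n k q0 Hk); unfold Cdiv; ring].
  unfold rogers_sum, conv.
  etransitivity; [exact (eq_sym (sum_n_mult_l (K := C_Ring) _ _ n))|].
  apply sum_n_ext_loc. intros k Hk.
  C_eq.
  change (@mult C_Ring ?u ?v) with (Cmult u v).
  rewrite qhyper_term_21 by exact q0.
  destruct (qpoch_reverse g q k g0 q0 Hg Hq (n - k) n ltac:(lia)) as [Hd E].
  rewrite <- E.
  (* Splitting off z^k lets it cancel one of the two factors w^k coming from e^{-2 i k theta}, which
     leaves the convolution summand. *)
  replace (z ^ n) with (z ^ (n - k) * z ^ k)
    by (rewrite <- Cpow_add_r; f_equal; lia).
  rewrite !Cpow_mult_l.
  assert (Hzk : z ^ k * w ^ k = 1) by (rewrite <- Cpow_mult_l, Hzw; apply Cpow_1_l).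
  transitivity (qpoch g q n / qpoch q q n *
    (qpoch (/ q ^ n) q k / qpoch (/ g * (q / q ^ n)) q k) * (q ^ k * (/ g) ^ k)
    * (qpoch g q k / qpoch q q k) * z ^ (n - k) * w ^ k * (z ^ k * w ^ k)).
  - assert (Hn := qpoch_neq_0 q q n Hq Hq). assert (Hk' := qpoch_neq_0 q q k Hq Hq).
    revert Hd Hn Hk'.
    generalize (qpoch (/ g * (q / q ^ n)) q k), (qpoch (/ q ^ n) q k), ((/ g) ^ k).
    intros. field. repeat split; assumption.
  - rewrite Hzk. ring.
Qed.

(** * The contiguous relation *)

(* The coefficient of [u^k] in the [n]-th 2phi1 of the theorem (with [u = t^2]),
   multiplied by [(b;q)_n / (g;q)_n]. *)
Definition coef (b g q : C) (n k : nat) : C :=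
  qpoch b q (n + k) * qpoch (b * / g) q k * g ^ k * (1 - g * q ^ n)
  / (qpoch q q k * qpoch g q (S (n + k))).

Section Coef.

Context (b g q : C) (g0 : g <> 0) (q0 : q <> 0)
  (Hg : (Cmod g < 1)%R) (Hq : (Cmod q < 1)%R).

Notation f := (coef b g q).
(* [2 x P_m = alpha m P_{m+1} + delta m P_{m-1}]; [delta 0] is never used. *)
Notation alpha m := ((1 - q ^ S m) / (1 - g * q ^ m)).
Notation delta m := ((1 - g ^ 2 * q ^ (m - 1)) / (1 - g * q ^ m)).

(** The products merge as (b;q)_n (b q^n;q)_k = (b;q)_{n+k} and (g;q)_n (1 - g q^n) (g q^{n+1};q)_k
    = (g;q)_{n+k+1}; this is the origin of the factor 1 - g q^n in [coef]. *)
Lemma coef_hyper (n k : nat) (u : C) :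
  qpoch b q n / qpoch g q n
  * qhyper_term [b * / g; b * q ^ n] [g * q ^ (n + 1)] q (g * u) k
  = f n k * u ^ k.
Proof.
  rewrite qhyper_term_21 by exact q0. unfold coef.
  replace (S (n + k)) with ((n + 1) + k)%nat by lia.
  rewrite (qpoch_add b q n k), (qpoch_add g q (n + 1) k), Cpow_mult_l.
  replace (qpoch g q (n + 1)) with (qpoch g q n * (1 - g * q ^ n))
    by (rewrite Nat.add_1_r; reflexivity).
  field. repeat split; first
    [ apply one_minus_mult_pow_neq_0; assumption
    | apply qpoch_neq_0; assumption
    | apply qpoch_neq_0; [apply Cmod_mult_pow_lt|]; assumption ].
Qed.

(** Coefficient of t^{2k+2} in the relation L_0 = delta_1 H_1, where F_n(t) = sum_k f n k
    t^{n+2k}. *)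
Lemma coef_contiguous_0 (k : nat) :
  (1 - q ^ (2 * S k)) * f 0 (S k) + (1 - b ^ 2 * q ^ (2 * k)) * f 0 k
  = delta 1 * (1 - b * q ^ S (2 * k)) * f 1 k.
Proof.
  assert (Hp := fun i => qpoch_neq_0 q q i Hq Hq).
  assert (Hs := fun i => one_minus_mult_pow_neq_0 q q i Hq Hq).
  assert (Hp' := fun i => qpoch_neq_0 g q i Hg Hq).
  assert (Hs' := fun i => one_minus_mult_pow_neq_0 g q i Hg Hq).
  assert (H1 := Hs k). assert (H2 := Hp k). assert (H3 := Hp' (S k)).
  assert (H4 := Hs' (S k)). assert (H5 := Hs' 1%nat).
  unfold coef. replace (2 * S k)%nat with (S (S (k + k))) by lia.
  replace (2 * k)%nat with (k + k)%nat by lia.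
  rewrite !Nat.add_0_l. change (1 + k)%nat with (S k).
  change (qpoch g q (S (S k))) with (qpoch g q (S k) * (1 - g * q ^ S k)).
  change (qpoch b q (S k)) with (qpoch b q k * (1 - b * q ^ k)).
  change (qpoch q q (S k)) with (qpoch q q k * (1 - q * q ^ k)).
  change (qpoch (b * / g) q (S k)) with (qpoch (b * / g) q k * (1 - (b * / g) * q ^ k)).
  change (1 - 1)%nat with 0%nat.
  rewrite !Cpow_S, Cpow_add_r in *. simpl (q ^ 0) in *. rewrite Cmult_1_r in H5.
  field. repeat split; assumption.
Qed.

(** Coefficient of t^{m+2k+3} in L_{m+1} = alpha_m H_m + delta_{m+2} H_{m+2}. Each dilation t -> q t
    contributes q to the degree of the monomial it acts on. *)
Lemma coef_contiguous (m k : nat) :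
  (1 - q ^ (S m + 2 * S k)) * f (S m) (S k) + (1 - b ^ 2 * q ^ (S m + 2 * k)) * f (S m) k
  = alpha m * (1 - b * q ^ (m + 2 * S k)) * f m (S k)
    + delta (S (S m)) * (1 - b * q ^ (S (S m) + 2 * k)) * f (S (S m)) k.
Proof.
  assert (Hp := fun i => qpoch_neq_0 q q i Hq Hq).
  assert (Hs := fun i => one_minus_mult_pow_neq_0 q q i Hq Hq).
  assert (Hp' := fun i => qpoch_neq_0 g q i Hg Hq).
  assert (Hs' := fun i => one_minus_mult_pow_neq_0 g q i Hg Hq).
  assert (H1 := Hs k). assert (H2 := Hp k). assert (H3 := Hp' (S (S (m + k)))).
  assert (H4 := Hs' (S (S (m + k)))). assert (H5 := Hs' m). assert (H6 := Hs' (S (S m))).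
  clear Hp Hs Hp' Hs'.
  unfold coef.
  replace (S m + S k)%nat with (S (S (m + k))) by lia.
  replace (S m + k)%nat with (S (m + k)) by lia.
  replace (m + S k)%nat with (S (m + k)) by lia.
  replace (S (S m) + k)%nat with (S (S (m + k))) by lia.
  (* Writing the exponents through [m] and [k + k] turns every power of [q] into a monomial in q,
     q^m and q^k, which makes the claim a rational identity for [field]. *)
  replace (S m + 2 * S k)%nat with (S (S (S (m + (k + k))))) by lia.
  replace (S m + 2 * k)%nat with (S (m + (k + k))) by lia.
  replace (m + 2 * S k)%nat with (S (S (m + (k + k)))) by lia.
  replace (S (S m) + 2 * k)%nat with (S (S (m + (k + k)))) by lia.
  replace (S (S m) - 1)%nat with (S m) by lia.
  change (qpoch g q (S (S (S (m + k)))))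
    with (qpoch g q (S (S (m + k))) * (1 - g * q ^ S (S (m + k)))).
  change (qpoch b q (S (S (m + k)))) with (qpoch b q (S (m + k)) * (1 - b * q ^ S (m + k))).
  change (qpoch q q (S k)) with (qpoch q q k * (1 - q * q ^ k)).
  change (qpoch (b * / g) q (S k)) with (qpoch (b * / g) q k * (1 - (b * / g) * q ^ k)).
  revert H3. generalize (qpoch g q (S (S (m + k)))). intros G H3.
  rewrite !Cpow_S, !Cpow_add_r in *.
  field. repeat split; assumption.
Qed.
End Coef.

(** * Uniform bounds, and the contiguous relation for the summed series *)

Lemma is_series_0 : is_series (fun _ : nat => RtoC 0) (RtoC 0).
Proof.
  assert (H := is_series_finite (fun _ => RtoC 0) 0 (fun _ _ => eq_refl)).
  rewrite sum_O in H. exact H.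
Qed.

(** Comparison of coefficients in X + u Y: the factor [u] pairs B_k with A_{k+1}, and A_0 stands
    alone. *)
Lemma shifted_series_eq_0 (A B : nat -> C) (u X Y : C) :
  A O = 0 -> (forall k, A (S k) + B k = 0) ->
  is_series (fun k => A k * u ^ k) X -> is_series (fun k => B k * u ^ k) Y ->
  X + u * Y = 0.
Proof.
  intros HA HB HX HY.
  assert (HX' : is_series (fun k => A (S k) * u ^ S k) X).
  { apply (is_series_incr_1 (fun k => A k * u ^ k)). rewrite HA.
    change (is_series (fun k => A k * u ^ k) (X + 0 * u ^ 0)).
    replace (X + 0 * u ^ 0) with X by ring. exact HX. }
  assert (H := is_series_comb 1 u _ _ _ _ HX' HY).
  rewrite Cmult_1_l in H.
  apply (is_series_unique_C _ _ _ H).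
  apply (is_series_ext (fun _ => RtoC 0)); [|exact is_series_0].
  intros k. C_eq.
  rewrite Cpow_S.
  replace (1 * (A (S k) * (u * u ^ k)) + u * (B k * u ^ k))
    with ((A (S k) + B k) * (u * u ^ k)) by ring.
  rewrite HB. ring.
Qed.

Lemma Cmod_one_minus_le (a : C) : (Cmod a <= 1)%R -> (Cmod (1 - a) <= 2)%R.
Proof.
  intros Ha. eapply Rle_trans; [apply Cmod_triangle|].
  rewrite Cmod_1, Cmod_opp. lra.
Qed.

Lemma Cmod_one_minus_ge (a : C) : (1 - Cmod a <= Cmod (1 - a))%R.
Proof.
  pose proof (Cmod_triangle (1 - a) a) as H.
  replace (1 - a + a) with (RtoC 1) in H by ring. rewrite Cmod_1 in H. lra.
Qed.

Lemma Cmod_pow_le_1 (q : C) (n : nat) : (Cmod q <= 1)%R -> (Cmod (q ^ n) <= 1)%R.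
Proof.
  intros Hq. rewrite Cmod_pow, <- (pow1 n). apply pow_incr.
  split; [apply Cmod_ge_0|exact Hq].
Qed.

(** Each term of 1 + s + ... + s^m is at least s^m. *)
Lemma INR_mult_pow_le (s : R) (m : nat) :
  (0 <= s < 1)%R -> (INR (S m) * s ^ m <= 1 / (1 - s))%R.
Proof.
  intros Hs. eapply Rle_trans; [|apply (geom_sum_le s (S m)); exact Hs].
  induction m as [|m IH].
  - simpl. right. field. lra.
  - replace ((1 - s ^ S (S m)) / (1 - s))%R
      with ((1 - s ^ S m) / (1 - s) + s ^ S m)%R by (simpl; field; lra).
    rewrite S_INR, Rmult_plus_distr_r, Rmult_1_l.
    apply Rplus_le_compat_r. eapply Rle_trans; [|exact IH].
    apply Rmult_le_compat_l; [apply pos_INR|]. simpl.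
    pose proof (pow_le s m (proj1 Hs)). nra.
Qed.

(** With s = sqrt |t|, write |t|^n = s^n s^n: one factor absorbs the linear growth of the
    polynomials, the other remains as the geometric majorant. *)
Lemma rogers_sum_geom (g q z w t : C) :
  (Cmod q < 1)%R -> Cmod z = 1%R -> Cmod w = 1%R -> (Cmod t < 1)%R ->
  exists M r, (0 <= r < 1)%R /\ (0 <= M)%R /\
  forall n, (Cmod (rogers_sum g q z w n) * Cmod t ^ n <= M * r ^ n)%R.
Proof.
  intros Hq Hz Hw Ht.
  destruct (rogers_sum_Cmod_le g q z w Hq Hz Hw) as [B HB].
  assert (Hs : (0 <= sqrt (Cmod t) < 1)%R).
  { split; [apply sqrt_pos|]. rewrite <- sqrt_1. apply sqrt_lt_1; [apply Cmod_ge_0|lra|lra]. }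
  set (s := sqrt (Cmod t)) in *.
  assert (HB0 : (0 <= B)%R).
  { specialize (HB O). pose proof (Cmod_ge_0 (rogers_sum g q z w 0)).
    simpl in HB. lra. }
  assert (H1 : (0 < / (1 - s))%R) by (apply Rinv_0_lt_compat; lra).
  exists (B * (1 / (1 - s)))%R, s. split; [exact Hs|]. split.
  { apply Rmult_le_pos; [exact HB0|]. lra. }
  intros n. replace (Cmod t) with (s * s)%R by (apply sqrt_sqrt, Cmod_ge_0).
  rewrite Rpow_mult_distr, <- Rmult_assoc.
  assert (H2 : (0 <= s ^ n)%R) by (apply pow_le; lra).
  apply Rmult_le_compat_r; [exact H2|].
  eapply Rle_trans; [apply Rmult_le_compat_r; [exact H2|apply HB]|].
  replace (INR (S n) * B * s ^ n)%R with (B * (INR (S n) * s ^ n))%R by ring.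
  apply Rmult_le_compat_l; [exact HB0|]. apply INR_mult_pow_le. exact Hs.
Qed.

(** All q-shifted factorials are bounded uniformly in [n] and [k], and |1 - g q^n| <= 2; the decay
    comes from g^k alone, so the series converges for all |u| <= 1. *)
Lemma coef_Cmod_le (b g q : C) :
  (Cmod g < 1)%R -> (Cmod q < 1)%R ->
  exists K, (0 <= K)%R /\ forall n k, (Cmod (coef b g q n k) <= K * Cmod g ^ k)%R.
Proof.
  intros Hg Hq.
  set (e1 := exp (Cmod b / (1 - Cmod q))).
  set (e2 := exp (Cmod (b * / g) / (1 - Cmod q))).
  set (e3 := exp (- (Cmod q / (1 - Cmod q) / (1 - Cmod q)))).
  set (e4 := exp (- (Cmod g / (1 - Cmod g) / (1 - Cmod q)))).
  assert (He : (0 < / (e3 * e4))%R)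
    by (apply Rinv_0_lt_compat, Rmult_lt_0_compat; apply exp_pos).
  assert (He' : (0 <= e1 * e2 * 2)%R).
  { apply Rmult_le_pos; [|lra]. apply Rmult_le_pos; left; apply exp_pos. }
  exists (e1 * e2 * 2 * / (e3 * e4))%R. split; [nra|].
  intros n k. unfold coef.
  assert (Hd1 := qpoch_neq_0 q q k Hq Hq). assert (Hd2 := qpoch_neq_0 g q (S (n + k)) Hg Hq).
  rewrite Cmod_div by (apply Cmult_neq_0; assumption).
  rewrite !Cmod_mult, Cmod_pow.
  replace (e1 * e2 * 2 * / (e3 * e4) * Cmod g ^ k)%R
    with (e1 * e2 * Cmod g ^ k * 2 * / (e3 * e4))%R by ring.
  assert (Hgk : (0 <= Cmod g ^ k)%R) by apply pow_le, Cmod_ge_0.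
  apply Rmult_le_compat.
  - repeat apply Rmult_le_pos; try apply Cmod_ge_0. exact Hgk.
  - left. apply Rinv_0_lt_compat, Rmult_lt_0_compat; apply Cmod_gt_0; assumption.
  - apply Rmult_le_compat.
    + repeat apply Rmult_le_pos; try apply Cmod_ge_0. exact Hgk.
    + apply Cmod_ge_0.
    + apply Rmult_le_compat_r; [exact Hgk|].
      apply Rmult_le_compat; try apply Cmod_ge_0;
        (apply qpoch_Cmod_le; [apply Rle_refl|exact Hq]).
    + apply Cmod_one_minus_le. left. apply Cmod_mult_pow_lt; assumption.
  - apply Rinv_le_contravar; [apply Rmult_lt_0_compat; apply exp_pos|].
    apply Rmult_le_compat; try (left; apply exp_pos);
      (apply qpoch_Cmod_ge; [split; [apply Rle_refl|assumption]|exact Hq]).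
Qed.

Section Series.

Context (b g q : C) (g0 : g <> 0)
  (Hg : (Cmod g < 1)%R) (Hq : (Cmod q < 1)%R).

Notation f := (coef b g q).
Notation alpha m := ((1 - q ^ S m) / (1 - g * q ^ m)).
Notation delta m := ((1 - g ^ 2 * q ^ (m - 1)) / (1 - g * q ^ m)).

Definition hyper (m : nat) (u : C) : C := Cseries (fun k => f m k * u ^ k).

Lemma coef_term_le (K : R) (m k : nat) (u : C) :
  (forall n k, Cmod (f n k) <= K * Cmod g ^ k)%R -> (Cmod u <= 1)%R ->
  (Cmod (f m k * u ^ k) <= K * Cmod g ^ k)%R.
Proof.
  intros HK Hu. rewrite Cmod_mult, <- (Rmult_1_r (K * _)).
  apply Rmult_le_compat; try apply Cmod_ge_0; [apply HK|].
  apply Cmod_pow_le_1. exact Hu.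
Qed.

Lemma hyper_correct (m : nat) (u : C) :
  (Cmod u <= 1)%R -> is_series (fun k => f m k * u ^ k) (hyper m u).
Proof.
  intros Hu. apply Cseries_correct.
  destruct (coef_Cmod_le b g q Hg Hq) as [K [_ HK]].
  apply (ex_series_geom_dominated _ K (Cmod g)).
  - split; [apply Cmod_ge_0|exact Hg].
  - intros k. apply coef_term_le; assumption.
Qed.

Lemma hyper_Cmod_le : exists K, (0 <= K)%R /\
  forall m u, (Cmod u <= 1)%R -> (Cmod (hyper m u) <= K)%R.
Proof.
  destruct (coef_Cmod_le b g q Hg Hq) as [K [K0 HK]].
  exists (K / (1 - Cmod g))%R. split.
  - apply Rmult_le_pos; [exact K0|]. left. apply Rinv_0_lt_compat. lra.
  - intros m u Hu. apply (is_series_Cmod_le (fun k => f m k * u ^ k)).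
    + split; [apply Cmod_ge_0|exact Hg].
    + intros k. apply coef_term_le; assumption.
    + apply hyper_correct. exact Hu.
Qed.

Lemma hyper_0_near_1 : exists K,
  forall u, (Cmod u <= 1)%R -> (Cmod (hyper 0 u - 1) <= K * Cmod u)%R.
Proof.
  destruct (coef_Cmod_le b g q Hg Hq) as [K [K0 HK]].
  exists (K / (1 - Cmod g))%R. intros u Hu.
  assert (H0 : f 0 0 * u ^ 0 = 1).
  { unfold coef. simpl. field. apply one_minus_neq_0. exact Hg. }
  rewrite <- H0.
  replace (K / (1 - Cmod g) * Cmod u)%R with (K * Cmod u / (1 - Cmod g))%R by (field; lra).
  apply (is_series_Cmod_head_le (fun k => f 0 k * u ^ k)).
  - split; [apply Cmod_ge_0|exact Hg].
  - intros k. pose proof (coef_term_le K 0 (S k) u HK Hu) as H.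
    rewrite Cpow_S. replace (f 0 (S k) * (u * u ^ k)) with (u * (f 0 (S k) * u ^ k)) by ring.
    rewrite !Cmod_mult. rewrite (Rmult_comm K), Rmult_assoc.
    apply Rmult_le_compat_l; [apply Cmod_ge_0|].
    pose proof (HK O (S k)) as H1. pose proof (Cmod_pow_le_1 u k Hu) as H2.
    pose proof (Cmod_ge_0 (f 0 (S k))) as H3. pose proof (Cmod_ge_0 (u ^ k)) as H4.
    pose proof (pow_le (Cmod g) k (Cmod_ge_0 g)) as H5. simpl in H1.
    assert (H6 : (K * (Cmod g * Cmod g ^ k) <= K * Cmod g ^ k)%R).
    { apply Rmult_le_compat_l; [exact K0|]. nra. }
    nra.
  - apply hyper_correct. exact Hu.
Qed.

(** The dilation t -> q t sends u = t^2 to q^2 u, which multiplies the k-th coefficient by q^{2k}.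
    So the factors linear in q^{2k} of the coefficient identities become combinations of values at u
    and q^2 u. *)
Lemma hyper_dilate (m : nat) (c d u : C) :
  (Cmod u <= 1)%R ->
  is_series (fun k => (c + d * q ^ (2 * k)) * f m k * u ^ k)
    (c * hyper m u + d * hyper m (q ^ 2 * u)).
Proof.
  intros Hu.
  assert (Hu' : (Cmod (q ^ 2 * u) <= 1)%R).
  { rewrite Cmod_mult. pose proof (Cmod_pow_le_1 q 2 ltac:(lra)).
    pose proof (Cmod_ge_0 u). pose proof (Cmod_ge_0 (q ^ 2)). nra. }
  apply (is_series_ext (fun k => c * (f m k * u ^ k) + d * (f m k * (q ^ 2 * u) ^ k))).
  - intros k. C_eq.
    rewrite Cpow_mult_l, <- Cpow_mult_r. ring.
  - apply is_series_comb; apply hyper_correct; assumption.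
Qed.

Lemma hyper_contiguous_0 (u : C) :
  (Cmod u <= 1)%R ->
  (1 + u) * hyper 0 u - (1 + b ^ 2 * u) * hyper 0 (q ^ 2 * u)
  = delta 1 * u * (hyper 1 u - b * q * hyper 1 (q ^ 2 * u)).
Proof.
  intros Hu.
  (* [A] collects the terms of the relation without an explicit factor [u], [B] those with it;
     [coef_contiguous_0] says A_{k+1} + B_k = 0. *)
  set (A := fun k => (1 + - (1) * q ^ (2 * k)) * f 0 k).
  set (B := fun k => (1 + - b ^ 2 * q ^ (2 * k)) * f 0 k
                     + - delta 1 * ((1 + - (b * q) * q ^ (2 * k)) * f 1 k)).
  assert (HB := is_series_comb 1 (- delta 1) _ _ _ _
    (hyper_dilate 0 1 (- b ^ 2) u Hu) (hyper_dilate 1 1 (- (b * q)) u Hu)).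
  apply (is_series_ext _ (fun k => B k * u ^ k)) in HB; [|intros k; unfold B; C_eq; ring].
  apply Ceq_minus.
  rewrite <- (shifted_series_eq_0 A B u _ _) with (3 := hyper_dilate 0 1 (- (1)) u Hu) (4 := HB).
  - ring.
  - unfold A. simpl. ring.
  - intros k. unfold A, B. pose proof (coef_contiguous_0 b g q g0 Hg Hq k) as E.
    apply Ceq_minus in E. rewrite <- E, (Cpow_S q (2 * k)). ring.
Qed.

Lemma hyper_contiguous (m : nat) (u : C) :
  (Cmod u <= 1)%R ->
  (1 + u) * hyper (S m) u - (1 + b ^ 2 * u) * q ^ S m * hyper (S m) (q ^ 2 * u)
  = alpha m * (hyper m u - b * q ^ m * hyper m (q ^ 2 * u))
    + delta (S (S m)) * u * (hyper (S (S m)) u - b * q ^ S (S m) * hyper (S (S m)) (q ^ 2 * u)).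
Proof.
  intros Hu.
  set (A := fun k => (1 + - q ^ S m * q ^ (2 * k)) * f (S m) k
                     + - alpha m * ((1 + - (b * q ^ m) * q ^ (2 * k)) * f m k)).
  set (B := fun k => (1 + - (b ^ 2 * q ^ S m) * q ^ (2 * k)) * f (S m) k
    + - delta (S (S m)) * ((1 + - (b * q ^ S (S m)) * q ^ (2 * k)) * f (S (S m)) k)).
  assert (HA := is_series_comb 1 (- alpha m) _ _ _ _
    (hyper_dilate (S m) 1 (- q ^ S m) u Hu) (hyper_dilate m 1 (- (b * q ^ m)) u Hu)).
  apply (is_series_ext _ (fun k => A k * u ^ k)) in HA; [|intros k; unfold A; C_eq; ring].
  assert (HB := is_series_comb 1 (- delta (S (S m))) _ _ _ _
    (hyper_dilate (S m) 1 (- (b ^ 2 * q ^ S m)) u Hu)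
    (hyper_dilate (S (S m)) 1 (- (b * q ^ S (S m))) u Hu)).
  apply (is_series_ext _ (fun k => B k * u ^ k)) in HB; [|intros k; unfold B; C_eq; ring].
  apply Ceq_minus.
  rewrite <- (shifted_series_eq_0 A B u _ _) with (3 := HA) (4 := HB).
  - ring.
  (* The constant coefficient in [u], which [coef_contiguous] does not cover: (1 - q^{m+1}) f (m+1)
     0 = alpha_m (1 - b q^m) f m 0. *)
  - unfold A, coef. rewrite !Nat.add_0_r.
    change (qpoch g q (S (S m))) with (qpoch g q (S m) * (1 - g * q ^ S m)).
    change (qpoch b q (S m)) with (qpoch b q m * (1 - b * q ^ m)).
    change (q ^ (2 * 0)) with (RtoC 1). simpl (qpoch _ q 0). simpl (g ^ 0).
    assert (H1 := qpoch_neq_0 g q (S m) Hg Hq).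
    assert (H2 := one_minus_mult_pow_neq_0 g q (S m) Hg Hq).
    assert (H3 := one_minus_mult_pow_neq_0 g q m Hg Hq).
    generalize dependent (qpoch g q (S m)). intros G H1.
    field. repeat split; assumption.
  - intros k. unfold A, B. pose proof (coef_contiguous b g q g0 Hg Hq m k) as E.
    apply Ceq_minus in E. rewrite <- E, !Cpow_add_r. ring.
Qed.
End Series.

(** * The functional equation *)

(** Summation by parts for a tridiagonal matrix and its transpose: every product P_i H_j with i, j
    <= N cancels, and only the pairs straddling N and N + 1 remain. *)
Lemma three_term_telescope (sig : C) (al de P H L : nat -> C) (N : nat) :
  sig * P O = al O * P 1%nat ->
  (forall n, sig * P (S n) = al (S n) * P (S (S n)) + de (S n) * P n) ->
  L O = de 1%nat * H 1%nat ->
  (forall n, L (S n) = al n * H n + de (S (S n)) * H (S (S n))) ->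
  sum_n (fun m => P m * L m - sig * P m * H m) N
  = de (S N) * P N * H (S N) - al N * P (S N) * H N :> C.
Proof.
  intros P0 PS L0 LS. induction N as [|N IH].
  - rewrite sum_n_0, P0, L0. ring.
  - rewrite sum_n_S, IH, PS, LS. ring.
Qed.

Lemma Cfilterlim_0_geom (u : nat -> C) (M r : R) :
  (0 <= r < 1)%R -> (forall n, Cmod (u n) <= M * r ^ n)%R ->
  filterlim u eventually (locally (RtoC 0)).
Proof.
  intros Hr Hu. apply Cfilterlim_iff.
  apply (is_lim_seq_le_le (fun _ => 0%R) _ (fun n => M * r ^ n)%R).
  - intros n. split; [apply Cmod_ge_0|].
    replace (u n - 0) with (u n) by ring. apply Hu.
  - apply is_lim_seq_const.
  - replace (Finite 0) with (Finite (M * 0)) by (f_equal; ring).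
    apply is_lim_seq_mult'; [apply is_lim_seq_const|].
    apply is_lim_seq_geom. rewrite Rabs_pos_eq; lra.
Qed.

(** The cosine determines the sine up to sign, so passing from theta to acos (cos theta) at most
    exchanges the two conjugate exponentials. *)
Lemma cis_acos_cos (theta : R) :
  (cis (acos (cos theta)) = cis theta /\ cis (- acos (cos theta)) = cis (- theta)) \/
  (cis (acos (cos theta)) = cis (- theta) /\ cis (- acos (cos theta)) = cis theta).
Proof.
  assert (Hc : cos (acos (cos theta)) = cos theta) by apply cos_acos, COS_bound.
  unfold cis. rewrite !cos_neg, !sin_neg, Hc.
  assert (Hs : (sin (acos (cos theta)) ^ 2 = sin theta ^ 2)%R).
  { pose proof (sin2_cos2 theta) as H1. pose proof (sin2_cos2 (acos (cos theta))) as H2.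
    rewrite Hc in H2. unfold Rsqr in *. simpl. lra. }
  assert (H0 : ((sin (acos (cos theta)) - sin theta)
    * (sin (acos (cos theta)) + sin theta) = 0)%R) by (simpl in Hs; lra).
  destruct (Rmult_integral _ _ H0) as [H|H].
  - left. replace (sin (acos (cos theta))) with (sin theta) by lra. split; reflexivity.
  - right. replace (sin (acos (cos theta))) with (- sin theta)%R by lra.
    rewrite Ropp_involutive. split; reflexivity.
Qed.

Lemma qhyper_eq_hyper (b g q u : C) (n : nat) :
  g <> 0 -> q <> 0 -> (Cmod b < 1)%R -> (Cmod g < 1)%R -> (Cmod q < 1)%R ->
  (Cmod u <= 1)%R ->
  qpoch b q n / qpoch g q n
  * qhyper [b * / g; b * q ^ n] [g * q ^ (n + 1)] q (g * u) = hyper b g q n u.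
Proof.
  intros g0 q0 Hb Hg Hq Hu.
  assert (Hc : qpoch b q n / qpoch g q n <> 0)
    by (apply Cmult_neq_0; [|apply Cinv_neq_0]; apply qpoch_neq_0; assumption).
  revert Hc. set (c := qpoch b q n / qpoch g q n). intros Hc.
  (* The value of the sum is left open and fixed by the convergence goal, hence treated first: the
     series of [hyper] is divided by the nonzero prefactor [c]. *)
  unfold qhyper. erewrite Cseries_unique; cycle 1.
  - refine (is_series_ext _ _ _ _
      (is_series_scal (/ c) _ _ (hyper_correct b g q Hg Hq n u Hu))).
    intros k. rewrite <- (coef_hyper b g q q0 Hg Hq n k u). fold c.
    C_eq.
    change (@scal _ _ ?x ?y) with (Cmult x y).
    rewrite Cmult_assoc, Cinv_l by exact Hc. apply Cmult_1_l.
  - change (@scal _ _ ?x ?y) with (Cmult x y).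
    rewrite Cmult_assoc, Cinv_r by exact Hc. apply Cmult_1_l.
Qed.

Section GeneratingFunction.

Context (b g q : C) (g0 : g <> 0)
  (Hg : (Cmod g < 1)%R) (Hq : (Cmod q < 1)%R).
Context (z w : C) (Hzw : z * w = 1) (Hz : Cmod z = 1%R) (Hw : Cmod w = 1%R).

Notation alpha m := ((1 - q ^ S m) / (1 - g * q ^ m)).
Notation delta m := ((1 - g ^ 2 * q ^ (m - 1)) / (1 - g * q ^ m)).
Notation P := (rogers_sum g q z w).

(** The function F_m(t) of the overview. *)
Definition monom_hyper (m : nat) (t : C) : C := t ^ m * hyper b g q m (t ^ 2).

Lemma monom_hyper_contiguous_0 (t : C) :
  (Cmod t <= 1)%R ->
  (1 + t ^ 2) * monom_hyper 0 t - (1 + b ^ 2 * t ^ 2) * monom_hyper 0 (q * t)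
  = delta 1 * (t * (monom_hyper 1 t - b * monom_hyper 1 (q * t))).
Proof.
  intros Ht. assert (E := hyper_contiguous_0 b g q g0 Hg Hq (t ^ 2) (Cmod_pow_le_1 t 2 Ht)).
  unfold monom_hyper. rewrite !Cpow_mult_l.
  change (t ^ 0) with (RtoC 1). change (q ^ 0) with (RtoC 1).
  rewrite !Cmult_1_l, E, !Cpow_1_r. generalize (delta 1). intros d. ring.
Qed.

Lemma monom_hyper_contiguous (m : nat) (t : C) :
  (Cmod t <= 1)%R ->
  (1 + t ^ 2) * monom_hyper (S m) t - (1 + b ^ 2 * t ^ 2) * monom_hyper (S m) (q * t)
  = alpha m * (t * (monom_hyper m t - b * monom_hyper m (q * t)))
    + delta (S (S m)) * (t * (monom_hyper (S (S m)) t - b * monom_hyper (S (S m)) (q * t))).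
Proof.
  intros Ht. assert (E := hyper_contiguous b g q g0 Hg Hq m (t ^ 2) (Cmod_pow_le_1 t 2 Ht)).
  unfold monom_hyper. rewrite !Cpow_mult_l.
  transitivity (t ^ S m * ((1 + t ^ 2) * hyper b g q (S m) (t ^ 2)
    - (1 + b ^ 2 * t ^ 2) * q ^ S m * hyper b g q (S m) (q ^ 2 * t ^ 2))); [ring|].
  rewrite E. generalize (alpha m), (delta (S (S m))). intros a d.
  rewrite !(Cpow_S t). simpl (t ^ 2). ring.
Qed.

Lemma monom_hyper_Cmod_le : exists K, (0 <= K)%R /\
  forall m t, (Cmod t <= 1)%R -> (Cmod (monom_hyper m t) <= K * Cmod t ^ m)%R.
Proof.
  destruct (hyper_Cmod_le b g q Hg Hq) as [K [K0 HK]]. exists K. split; [exact K0|].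
  intros m t Ht. unfold monom_hyper. rewrite Cmod_mult, Cmod_pow, Rmult_comm.
  apply Rmult_le_compat_r; [apply pow_le, Cmod_ge_0|].
  apply HK, Cmod_pow_le_1, Ht.
Qed.

(** The sum S(t) of the overview. *)
Definition gen (t : C) : C := Cseries (fun m => P m * monom_hyper m t).

Lemma gen_correct (t : C) :
  (Cmod t < 1)%R -> is_series (fun m => P m * monom_hyper m t) (gen t).
Proof.
  intros Ht. apply Cseries_correct.
  destruct (rogers_sum_geom g q z w t Hq Hz Hw Ht) as (M & r & Hr & M0 & HM).
  destruct monom_hyper_Cmod_le as (K & K0 & HK).
  apply (ex_series_geom_dominated _ (K * M) r Hr).
  intros m. rewrite Cmod_mult, Rmult_assoc.
  eapply Rle_trans; [apply Rmult_le_compat_l; [apply Cmod_ge_0|apply HK; lra]|].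
  replace (Cmod (P m) * (K * Cmod t ^ m))%R with (K * (Cmod (P m) * Cmod t ^ m))%R by ring.
  apply Rmult_le_compat_l; [exact K0|apply HM].
Qed.

Lemma Cmod_dilate_le (t : C) (n : nat) : (Cmod (q ^ n * t) <= Cmod t)%R.
Proof.
  rewrite Cmod_mult. pose proof (Cmod_pow_le_1 q n ltac:(lra)).
  pose proof (Cmod_ge_0 t). nra.
Qed.

Lemma Cmod_ratio_le (a : C) (n : nat) :
  (Cmod a <= 1)%R -> (Cmod ((1 - a) / (1 - g * q ^ n)) <= 2 / (1 - Cmod g))%R.
Proof.
  intros Ha. rewrite Cmod_div by (apply one_minus_mult_pow_neq_0; assumption).
  apply Rmult_le_compat.
  - apply Cmod_ge_0.
  - left. apply Rinv_0_lt_compat, Cmod_gt_0, one_minus_mult_pow_neq_0; assumption.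
  - apply Cmod_one_minus_le. exact Ha.
  - apply Rinv_le_contravar; [lra|].
    eapply Rle_trans; [|apply Cmod_one_minus_ge]. rewrite Cmod_mult.
    pose proof (Cmod_pow_le_1 q n ltac:(lra)). pose proof (Cmod_ge_0 g). nra.
Qed.

Lemma gen_functional_eq (t : C) :
  (Cmod t < 1)%R ->
  (1 - t * z) * (1 - t * w) * gen t
  = (1 - t * b * z) * (1 - t * b * w) * gen (q * t).
Proof.
  intros Ht.
  assert (Hqt : (Cmod (q * t) <= Cmod t)%R).
  { rewrite <- (Cpow_1_r q). apply Cmod_dilate_le. }
  set (H := fun m => t * (monom_hyper m t - b * monom_hyper m (q * t))).
  set (L := fun m => (1 + t ^ 2) * monom_hyper m t - (1 + b ^ 2 * t ^ 2) * monom_hyper m (q * t)).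
  (* The combination of S(t) and S(q t) to be shown zero, with z + w in the role of 2x; it is then
     regrouped into the summands that telescope. *)
  assert (HS := is_series_comb (1 + t ^ 2 - (z + w) * t)
    (- (1 + b ^ 2 * t ^ 2 - (z + w) * t * b)) _ _ _ _
    (gen_correct t Ht) (gen_correct (q * t) ltac:(lra))).
  apply (is_series_ext _ (fun m => P m * L m - (z + w) * P m * H m)) in HS;
    [|intros m; unfold L, H; C_eq; ring].
  assert (Htel : forall N, sum_n (fun m => P m * L m - (z + w) * P m * H m) N
    = delta (S N) * P N * H (S N) - alpha N * P (S N) * H N :> C).
  { intros N. apply (three_term_telescope _ (fun m => alpha m) (fun m => delta m)).
    - pose proof (rogers_sum_rec_0 g q z w Hq) as E.
      assert (H1 := one_minus_neq_0 g Hg). rewrite Cpow_1_r. change (q ^ 0) with (RtoC 1).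
      rewrite Cmult_1_r.
      replace ((1 - q) / (1 - g) * P 1) with ((1 - q) * P 1 / (1 - g)) by (field; exact H1).
      rewrite <- E. field. exact H1.
    - intros n. pose proof (rogers_sum_rec g q z w n Hq) as E. rewrite Hzw, Cmult_1_l in E.
      assert (H1 := one_minus_mult_pow_neq_0 g q (S n) Hg Hq).
      replace (S n - 1)%nat with n by lia.
      transitivity (((1 - q ^ S (S n)) * P (S (S n)) + (1 - g ^ 2 * q ^ n) * P n)
        / (1 - g * q ^ S n)).
      + rewrite <- E. field. exact H1.
      + field. exact H1.
    - apply monom_hyper_contiguous_0. lra.
    - intros n. apply monom_hyper_contiguous. lra. }
  destruct (rogers_sum_geom g q z w t Hq Hz Hw Ht) as (M & r & Hr & M0 & HM).
  destruct monom_hyper_Cmod_le as (K & K0 & HK).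
  assert (HH : forall m, (Cmod (H m) <= Cmod t * (K * (1 + Cmod b) * Cmod t ^ m))%R).
  { intros m. unfold H. rewrite Cmod_mult.
    apply Rmult_le_compat_l; [apply Cmod_ge_0|].
    eapply Rle_trans; [apply Cmod_triangle|]. rewrite Cmod_opp, Cmod_mult.
    pose proof (HK m t ltac:(lra)) as H1. pose proof (HK m (q * t) ltac:(lra)) as H2.
    assert (H3 : (Cmod (q * t) ^ m <= Cmod t ^ m)%R)
      by (apply pow_incr; split; [apply Cmod_ge_0|exact Hqt]).
    assert (H4 : (K * Cmod (q * t) ^ m <= K * Cmod t ^ m)%R)
      by (apply Rmult_le_compat_l; assumption).
    pose proof (Cmod_ge_0 b) as H5.
    assert (H6 : (Cmod b * Cmod (monom_hyper m (q * t)) <= Cmod b * (K * Cmod t ^ m))%R)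
      by (apply Rmult_le_compat_l; lra).
    lra. }
  assert (Hlim : is_series (fun m => P m * L m - (z + w) * P m * H m) (RtoC 0)).
  (* The constant is the bound 2 / (1 - |g|) for [alpha] and [delta], times the bound for a product
     P_i H_j, times 2 for the two boundary terms. *)
  { apply (Cfilterlim_0_geom _ (2 / (1 - Cmod g) * (K * (1 + Cmod b) * M) * 2) r Hr).
    intros N. rewrite Htel.
    set (c := (2 / (1 - Cmod g))%R). set (k := (K * (1 + Cmod b))%R) in *.
    assert (Hk0 : (0 <= k)%R)
      by (apply Rmult_le_pos; [exact K0|pose proof (Cmod_ge_0 b); lra]).
    assert (Hc0 : (0 <= c)%R)
      by (apply Rmult_le_pos; [lra|left; apply Rinv_0_lt_compat; lra]).
    assert (Hd : (Cmod (delta (S N)) <= c)%R).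
    { apply Cmod_ratio_le. rewrite Cmod_mult.
      pose proof (Cmod_pow_le_1 g 2 ltac:(lra)). pose proof (Cmod_pow_le_1 q (S N - 1) ltac:(lra)).
      pose proof (Cmod_ge_0 (g ^ 2)). pose proof (Cmod_ge_0 (q ^ (S N - 1))). nra. }
    assert (Ha : (Cmod (alpha N) <= c)%R).
    { apply Cmod_ratio_le, Cmod_pow_le_1. lra. }
    pose proof (Cmod_ge_0 t) as Ht0.
    assert (HtN : (0 <= Cmod t ^ N)%R) by (apply pow_le; exact Ht0).
    assert (HrN : (0 <= r ^ N)%R) by (apply pow_le; lra).
    assert (H1 : (Cmod (P N) * Cmod (H (S N)) <= k * (M * r ^ N))%R).
    { eapply Rle_trans; [apply Rmult_le_compat_l; [apply Cmod_ge_0|apply HH]|].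
      replace (Cmod (P N) * (Cmod t * (k * Cmod t ^ S N)))%R
        with (k * ((Cmod (P N) * Cmod t ^ N) * (Cmod t * Cmod t)))%R by (simpl; ring).
      apply Rmult_le_compat_l; [exact Hk0|].
      pose proof (HM N) as H1.
      assert (H2 : (0 <= Cmod (P N) * Cmod t ^ N)%R)
        by (apply Rmult_le_pos; [apply Cmod_ge_0|exact HtN]).
      assert (H3 : (0 <= Cmod t * Cmod t <= 1)%R) by nra.
      nra. }
    assert (H2 : (Cmod (P (S N)) * Cmod (H N) <= k * (M * r ^ N))%R).
    { eapply Rle_trans; [apply Rmult_le_compat_l; [apply Cmod_ge_0|apply HH]|].
      replace (Cmod (P (S N)) * (Cmod t * (k * Cmod t ^ N)))%R
        with (k * (Cmod (P (S N)) * Cmod t ^ S N))%R by (simpl; ring).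
      apply Rmult_le_compat_l; [exact Hk0|].
      eapply Rle_trans; [apply HM|]. apply Rmult_le_compat_l; [exact M0|].
      simpl. nra. }
    eapply Rle_trans; [apply Cmod_triangle|].
    rewrite Cmod_opp, <- !Cmult_assoc, !(Cmod_mult (_ / _)), !(Cmod_mult (P _)).
    assert (H3 := Rmult_le_compat _ _ _ _ (Cmod_ge_0 (delta (S N)))
      (Rmult_le_pos _ _ (Cmod_ge_0 (P N)) (Cmod_ge_0 (H (S N)))) Hd H1).
    assert (H4 := Rmult_le_compat _ _ _ _ (Cmod_ge_0 (alpha N))
      (Rmult_le_pos _ _ (Cmod_ge_0 (P (S N))) (Cmod_ge_0 (H N))) Ha H2).
    lra. }
  assert (E := is_series_unique_C _ _ _ HS Hlim).
  apply Ceq_minus. rewrite <- E.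
  replace ((1 - t * z) * (1 - t * w)) with (1 + t ^ 2 * (z * w) - (z + w) * t) by ring.
  replace ((1 - t * b * z) * (1 - t * b * w))
    with (1 + b ^ 2 * t ^ 2 * (z * w) - (z + w) * t * b) by ring.
  rewrite Hzw. ring.
Qed.

(** * Iteration of the functional equation and the infinite products *)

Lemma gen_iterate (t : C) (N : nat) :
  (Cmod t < 1)%R ->
  qpoch (t * z) q N * qpoch (t * w) q N * gen t
  = qpoch (t * b * z) q N * qpoch (t * b * w) q N * gen (q ^ N * t).
Proof.
  intros Ht. induction N as [|N IH].
  - simpl. rewrite !Cmult_1_l. reflexivity.
  - simpl qpoch.
    assert (E := gen_functional_eq (q ^ N * t)
      (Rle_lt_trans _ _ _ (Cmod_dilate_le t N) Ht)).
    rewrite (Cmult_assoc q), <- Cpow_S in E.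
    transitivity ((qpoch (t * z) q N * qpoch (t * w) q N * gen t)
      * ((1 - t * z * q ^ N) * (1 - t * w * q ^ N))); [ring|].
    rewrite IH.
    transitivity (qpoch (t * b * z) q N * qpoch (t * b * w) q N *
      ((1 - q ^ N * t * z) * (1 - q ^ N * t * w) * gen (q ^ N * t))); [ring|].
    rewrite E. ring.
Qed.

Lemma gen_dilate_lim (t : C) :
  (Cmod t < 1)%R ->
  filterlim (fun N => gen (q ^ N * t)) eventually (locally (RtoC 1)).
Proof.
  intros Ht.
  destruct (rogers_sum_geom g q z w t Hq Hz Hw Ht) as (M & r & Hr & M0 & HM).
  destruct monom_hyper_Cmod_le as (K & K0 & HK).
  destruct (hyper_0_near_1 b g q Hg Hq) as (K1 & HK1).
  assert (Hdiff : filterlim (fun N => gen (q ^ N * t) - 1) eventually (locally (RtoC 0))).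
  (* The first summand bounds the terms of index m >= 1, the second the deviation of the term of
     index 0 from 1; [Rabs] because [K1] comes without a sign. *)
  { apply (Cfilterlim_0_geom _ (K * M / (1 - r) + Rabs K1) (Cmod q)).
    { split; [apply Cmod_ge_0|exact Hq]. }
    intros N. set (u := q ^ N * t).
    assert (Hu : (Cmod u <= Cmod t)%R) by apply Cmod_dilate_le.
    assert (Hq1 : (0 <= Cmod q ^ N <= 1)%R).
    { rewrite <- Cmod_pow. split; [apply Cmod_ge_0|apply Cmod_pow_le_1; lra]. }
    assert (Hu' : Cmod u = (Cmod q ^ N * Cmod t)%R)
      by (unfold u; rewrite Cmod_mult, Cmod_pow; reflexivity).
    pose proof (Cmod_ge_0 t) as Ht0.
    assert (H1 : (Cmod (gen u - P 0 * monom_hyper 0 u) <= (K * M * Cmod q ^ N) / (1 - r))%R).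
    { apply (is_series_Cmod_head_le (fun m => P m * monom_hyper m u) _ _ _ Hr);
        [|apply gen_correct; lra].
      intros m. rewrite Cmod_mult.
      eapply Rle_trans; [apply Rmult_le_compat_l; [apply Cmod_ge_0|apply HK; lra]|].
      (* Of the m + 1 factors |q|^N just one is kept, enough for decay in N; the rest are at most
         1. *)
      assert (H2 : (Cmod u ^ S m <= Cmod q ^ N * Cmod t ^ S m)%R).
      { rewrite Hu', Rpow_mult_distr.
        apply Rmult_le_compat_r; [apply pow_le; exact Ht0|].
        simpl. rewrite <- (Rmult_1_r (Cmod q ^ N)) at 3.
        apply Rmult_le_compat_l; [lra|]. rewrite <- (pow1 m). apply pow_incr. exact Hq1. }
      replace (K * M * Cmod q ^ N * r ^ m)%R with (K * Cmod q ^ N * (M * r ^ m))%R by ring.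
      apply (Rle_trans _ (K * Cmod q ^ N * (Cmod (P (S m)) * Cmod t ^ S m))).
      - replace (K * Cmod q ^ N * (Cmod (P (S m)) * Cmod t ^ S m))%R
          with (Cmod (P (S m)) * (K * (Cmod q ^ N * Cmod t ^ S m)))%R by ring.
        apply Rmult_le_compat_l; [apply Cmod_ge_0|].
        apply Rmult_le_compat_l; assumption.
      - apply Rmult_le_compat_l; [apply Rmult_le_pos; lra|].
        eapply Rle_trans; [apply HM|]. apply Rmult_le_compat_l; [exact M0|].
        simpl. pose proof (pow_le r m (proj1 Hr)). nra. }
    assert (H2 : (Cmod (P 0 * monom_hyper 0 u - 1) <= Rabs K1 * Cmod q ^ N)%R).
    { rewrite rogers_sum_0. unfold monom_hyper. change (u ^ 0) with (RtoC 1). rewrite !Cmult_1_l.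
      eapply Rle_trans; [apply HK1, Cmod_pow_le_1; lra|].
      pose proof (Rle_abs K1) as H3. pose proof (Rabs_pos K1) as H4.
      assert (H5 : (0 <= Cmod (u ^ 2) <= Cmod q ^ N)%R).
      { split; [apply Cmod_ge_0|]. rewrite Cmod_pow, Hu'. simpl.
        assert (0 <= Cmod q ^ N * Cmod t <= Cmod q ^ N)%R by nra. nra. }
      nra. }
    replace (gen u - 1) with ((gen u - P 0 * monom_hyper 0 u) + (P 0 * monom_hyper 0 u - 1)) by ring.
    eapply Rle_trans; [apply Cmod_triangle|].
    replace ((K * M / (1 - r) + Rabs K1) * Cmod q ^ N)%R
      with (K * M * Cmod q ^ N / (1 - r) + Rabs K1 * Cmod q ^ N)%R by (field; lra).
    lra. }
  apply Cfilterlim_iff. apply Cfilterlim_iff in Hdiff.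
  apply (is_lim_seq_ext (fun N => Cmod (gen (q ^ N * t) - 1 - 0))); [|exact Hdiff].
  intros N. f_equal. ring.
Qed.

Lemma gen_eq (t : C) :
  (Cmod t < 1)%R ->
  gen t = qpoch_inf (t * b * z) q * qpoch_inf (t * b * w) q
          / (qpoch_inf (t * z) q * qpoch_inf (t * w) q).
Proof.
  intros Ht.
  assert (Hn1 : qpoch_inf (t * z) q <> 0)
    by (apply qpoch_inf_neq_0; [rewrite Cmod_mult, Hz; lra|exact Hq]).
  assert (Hn2 : qpoch_inf (t * w) q <> 0)
    by (apply qpoch_inf_neq_0; [rewrite Cmod_mult, Hw; lra|exact Hq]).
  assert (E : qpoch_inf (t * z) q * qpoch_inf (t * w) q * gen t
    = qpoch_inf (t * b * z) q * qpoch_inf (t * b * w) q * 1).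
  { assert (H1 := filterlim_Cmult _ _ _ _
      (filterlim_Cmult _ _ _ _ (qpoch_cv (t * z) q Hq) (qpoch_cv (t * w) q Hq))
      (filterlim_const (gen t))).
    assert (H2 := filterlim_Cmult _ _ _ _
      (filterlim_Cmult _ _ _ _ (qpoch_cv (t * b * z) q Hq) (qpoch_cv (t * b * w) q Hq))
      (gen_dilate_lim t Ht)).
    apply (filterlim_ext _ _ (fun N => eq_sym (gen_iterate t N Ht))) in H2.
    exact (filterlim_locally_unique (V := C_NormedModule) _ _ _ H1 H2). }
  rewrite Cmult_1_r in E. rewrite <- E. field. split; assumption.
Qed.

End GeneratingFunction.

Theorem theorem6 (x theta beta gamma : R) (t q : C)
  (hx : x = cos theta) (hx1 : (-1 <= x <= 1)%R)
  (ht : (Cmod t < 1)%R)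
  (hbeta : (-1 < beta < 1)%R) (hbeta0 : beta <> 0%R)
  (hgamma : (-1 < gamma < 1)%R) (hgamma0 : gamma <> 0%R)
  (hq : (0 < Cmod q < 1)%R) :
  is_series
    (fun n : nat =>
       qpoch beta q n / qpoch gamma q n
       * qhyper [beta * / gamma; beta * q ^ n] [gamma * q ^ (n + 1)] q
           (gamma * t ^ 2)
       * rogers n x gamma q * t ^ n)
    (qpochs_inf [t * beta * cis theta; t * beta * cis (- theta)] q
     / qpochs_inf [t * cis theta; t * cis (- theta)] q).
Proof.
  assert (g0 : RtoC gamma <> 0) by (intros H; apply RtoC_inj in H; contradiction).
  assert (q0 : q <> 0) by (apply Cmod_gt_0; lra).
  assert (Hg : (Cmod gamma < 1)%R) by (rewrite Cmod_R; apply Rabs_def1; lra).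
  assert (Hb : (Cmod beta < 1)%R) by (rewrite Cmod_R; apply Rabs_def1; lra).
  assert (Hq : (Cmod q < 1)%R) by lra.
  assert (Hser := gen_correct beta gamma q Hg Hq (cis (acos x)) (cis (- acos x))
    (Cmod_cis _) (Cmod_cis _) t ht).
  rewrite (gen_eq beta gamma q g0 Hg Hq _ _ (cis_mult_opp _)
    (Cmod_cis _) (Cmod_cis _) t ht) in Hser.
  assert (Hsym : qpochs_inf [t * beta * cis theta; t * beta * cis (- theta)] q
     / qpochs_inf [t * cis theta; t * cis (- theta)] q
    = qpoch_inf (t * beta * cis (acos x)) q * qpoch_inf (t * beta * cis (- acos x)) q
      / (qpoch_inf (t * cis (acos x)) q * qpoch_inf (t * cis (- acos x)) q)).
  { unfold qpochs_inf. simpl fold_right. rewrite !Cmult_1_r.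
    (* If the exponentials are exchanged, swapping the two factors in numerator and denominator
       restores the claim. *)
    destruct (cis_acos_cos theta) as [[E1 E2]|[E1 E2]]; rewrite hx, E1, E2;
      [reflexivity|].
    rewrite (Cmult_comm (qpoch_inf (t * beta * cis theta) q)),
      (Cmult_comm (qpoch_inf (t * cis theta) q)). reflexivity. }
  rewrite Hsym. refine (is_series_ext _ _ _ _ Hser).
  intros n. C_eq.
  rewrite rogers_eq_rogers_sum by assumption.
  assert (E : qpoch beta q n / qpoch gamma q n
    * qhyper [beta * / gamma; beta * q ^ n] [gamma * q ^ (n + 1)] q (gamma * t ^ 2)
    = hyper beta gamma q n (t ^ 2)).
  { apply qhyper_eq_hyper; try assumption. apply Cmod_pow_le_1. lra. }
  rewrite E. unfold monom_hyper. ring.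
Qed.
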